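(* Let $d\ge 1$, let $Sol_d=F_d/(F_d)''$ be the free solvable group of level two with generators $x_1,\dots,x_d$, let $E^d$ be the one-dimensional lattice complex of $\mathbb{Z}^d$, and let $\bar\beta\in H^2(\mathbb{Z}^d;H_1(E^d))$ be the canonical cohomology class defined in the context. Then the extension of the group $H_1(E^d)$ by the group of shifts $\mathbb{Z}^d$ (acting on $H_1(E^d)$ by translations) with the cohomology class $\bar\beta$ is canonically isomorphic to $Sol_d$. Under this isomorphism $\varphi$: the image of $H_1(E^d)$ is exactly the commutator subgroup $[Sol_d,Sol_d]$; for $i\neq j$ the image of the elementary $(i,j)$-coordinate cycle is the commutator $[x_i,x_j]$; and the action of $\mathbb{Z}^d$ on cycles by shifts turns into the action of $\mathbb{Z}^d$ on the commutator subgroup by inner automorphisms, i.e. for $k=(k_1,\dots,k_d)\in\mathbb{Z}^d$ and $c\in H_1(E^d)$, $\varphi(k\cdot c)=x_1^{k_1}\cdots x_d^{k_d}\,\varphi(c)\,(x_1^{k_1}\cdots x_d^{k_d})^{-1}$.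
   Context: $F_d$ is the free group on $d$ generators and $G''=[[G,G],[G,G]]$ is the second commutator subgroup (second commutant) of a group $G$; $x_1,\dots,x_d$ are the images in $Sol_d$ of the free generators, and $[a,b]=aba^{-1}b^{-1}$. Conjugation by $x_1^{k_1}\cdots x_d^{k_d}$ restricted to the (abelian) commutator subgroup of $Sol_d$ does not depend on the order of the factors, so it defines an action of $\mathbb{Z}^d$. $E^d$ is the Cayley graph of $\mathbb{Z}^d$ with respect to the standard generators $e_1,\dots,e_d$, regarded as a one-dimensional complex (the union of all shifts of the coordinate axes of $\mathbb{R}^d$ by integer vectors). $H_1(E^d)$ is its first homology group with integer coefficients, i.e. the group of integral $1$-cycles. $\mathbb{Z}^d$ acts on $E^d$, hence on $1$-chains and on $H_1(E^d)$, by shifts. The elementary $(i,j)$-coordinate cycle is the class of the closed path going around the two-dimensional cell with nodes $0,\ e_i,\ e_i+e_j,\ e_j$ in this order. The class $\bar\beta$: for every $v\in\mathbb{Z}^d$ choose a finite edge path $\tau_v$ in $E^d$ from $0$ to $v$. For $v,w\in\mathbb{Z}^d$ let $\beta(v,w)\in H_1(E^d)$ be the class of the closed path formed by $\tau_v$, followed by the shifted path $v+\tau_w$, followed by $\tau_{v+w}$ traversed in reverse (as chains, $\beta(v,w)=\tau_v+(v+\tau_w)-\tau_{v+w}$). This is a $2$-cocycle of $\mathbb{Z}^d$ with values in the $\mathbb{Z}^d$-module $H_1(E^d)$; its cohomology class does not depend on the choice of $(\tau_v)$ and is denoted $\bar\beta$. ''Extension of $A$ by $Q$'' here means that $A$ is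 the normal abelian subgroup and $Q$ is the quotient acting on $A$; the extension with cocycle $\beta$ is the set $H_1(E^d)\times\mathbb{Z}^d$ with product $(c,v)(c',w)=(c+v\cdot c'+\beta(v,w),\,v+w)$. *)

(* Defs.v *)
From HB Require Import structures.
From mathcomp Require Import all_boot all_order all_algebra.
From mathcomp Require Import boolp classical_sets.
From mathcomp Require Import freeg.

Set Implicit Arguments.
Unset Strict Implicit.
Unset Printing Implicit Defensive.

Import GRing.Theory.

(* Groups are the possibly infinite [groupType]s of mathcomp's [monoid.v].
   The commutator is written out as [a * b * a^-1 * b^-1] throughout, because
   mathcomp's [[~ a, b]] is [a^-1 * b^-1 * a * b]. *)

Section Subgroups.
Local Open Scope classical_set_scope.
Local Open Scope group_scope.
Variable G : groupType.
Implicit Types (A H : set G) (g a b : G).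

Definition is_subgroup H := H 1 /\ forall a b, H a -> H b -> H (a * b^-1).

Definition is_conj_stable A := forall g a, A a -> A (g * a * g^-1).

Definition generated A : set G := smallest is_subgroup A.

Definition comm_subgroup A : set G :=
  generated [set g | exists a b, [/\ A a, A b & g = a * b * a^-1 * b^-1]].

Definition derived1 : set G := comm_subgroup setT.

Definition derived2 : set G := comm_subgroup derived1.

Lemma generated_subgroup A : is_subgroup (generated A).
Proof.
split=> [H [[H1 _] _] //|a b Ha Hb H sH]; case: (sH) => [[_ HD] _].
by apply: HD; [apply: Ha|apply: Hb].
Qed.

Lemma comm_subgroup_conj A : is_conj_stable A -> is_conj_stable (comm_subgroup A).
Proof.
move=> Aconj g a Ha.
have /Ha // : is_subgroup [set h | comm_subgroup A (g * h * g^-1)] /\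
    [set h | exists a b, [/\ A a, A b & h = a * b * a^-1 * b^-1]]
      `<=` [set h | comm_subgroup A (g * h * g^-1)].
have [S1 SD] : is_subgroup (comm_subgroup A) by exact: generated_subgroup.
split; first split=> /= [|u v Hu Hv].
- by rewrite mulg1 mulgV.
- suff -> : g * (u * v^-1) * g^-1 = (g * u * g^-1) * (g * v * g^-1)^-1 by exact: SD.
  by rewrite !invgM invgK !mulgA mulgVK.
move=> _ [u [v [Au Av ->]]] H [_ /= sub].
apply: sub; exists (g * u * g^-1), (g * v * g^-1).
split; [exact: Aconj | exact: Aconj |].
by rewrite !invgM !invgK !mulgA !mulgVK.
Qed.

Record normal_subgroup := NormalSubgroup {
  normal_set :> set G;
  normal_is_subgroup : is_subgroup normal_set;
  normal_conj : is_conj_stable normal_set }.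

Lemma derived2_conj : is_conj_stable derived2.
Proof. by do 2!apply: comm_subgroup_conj. Qed.

Definition derived2_normal : normal_subgroup :=
  NormalSubgroup (generated_subgroup _) derived2_conj.

End Subgroups.

Arguments derived1 : clear implicits.
Arguments derived2 : clear implicits.
Arguments derived2_normal : clear implicits.

Section QuotientGroup.
Local Open Scope quotient_scope.
Local Open Scope group_scope.
Variables (G : groupType) (N : normal_subgroup G).
Implicit Types a b c : G.

Definition coset_rel : rel G := fun a b => `[< normal_set N (a * b^-1) >].

Lemma coset_relP a b : reflect (normal_set N (a * b^-1)) (coset_rel a b).
Proof. exact: asboolP. Qed.

Lemma coset_rel_equiv : equiv_class_of coset_rel.
Proof.
have [N1 ND] := normal_is_subgroup N.
split=> [a|a b|b a c].
- by apply/coset_relP; rewrite mulgV.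
- suff sym u v : coset_rel u v -> coset_rel v u.
    by apply/idP/idP; exact: sym.
  by move=> /coset_relP /(ND _ _ N1) H; apply/coset_relP; rewrite mul1g invgF in H.
- move=> /coset_relP Hab /coset_relP Hbc; apply/coset_relP.
  have Hcb : normal_set N (c * b^-1) by move: (ND _ _ N1 Hbc); rewrite mul1g invgF.
  by move: (ND _ _ Hab Hcb); rewrite invgF divgKA.
Qed.

Canonical coset_equiv := EquivRelPack coset_rel_equiv.

Definition quotient_group := {eq_quot coset_rel}.

HB.instance Definition _ := Choice.on quotient_group.
HB.instance Definition _ : EqQuotient G coset_rel quotient_group :=
  EqQuotient.on quotient_group.

Definition quotient_proj (a : G) : quotient_group := \pi_quotient_group a.

Definition quotient_one : quotient_group := quotient_proj 1.
Definition quotient_inv (p : quotient_group) := quotient_proj (repr p)^-1.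
Definition quotient_mul (p q : quotient_group) :=
  quotient_proj (repr p * repr q).

Lemma quotient_projP a b :
  quotient_proj a = quotient_proj b <-> normal_set N (a * b^-1).
Proof.
split=> [/eqmodP /coset_relP //|H]; by apply/eqmodP/coset_relP.
Qed.

Lemma quotient_repr p : quotient_proj (repr p) = p.
Proof. exact: reprK. Qed.

Lemma normal_repr a : normal_set N (a * (repr (quotient_proj a))^-1).
Proof. by apply/quotient_projP; rewrite quotient_repr. Qed.

Lemma normalM a b : normal_set N a -> normal_set N b -> normal_set N (a * b).
Proof.
have [N1 ND] := normal_is_subgroup N.
move=> Na /(ND _ _ N1); rewrite mul1g => Nb.
by move: (ND _ _ Na Nb); rewrite invgK.
Qed.

Lemma quotient_projM a b :
  quotient_mul (quotient_proj a) (quotient_proj b) = quotient_proj (a * b).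
Proof.
apply/esym/quotient_projP.
set a' := repr _; set b' := repr _.
suff -> : a * b * (a' * b')^-1 = (a * (b * b'^-1) * a^-1) * (a * a'^-1).
  by apply: normalM; [apply: normal_conj; exact: normal_repr | exact: normal_repr].
by rewrite invgM !mulgA mulgVK.
Qed.

Lemma quotient_projV a : quotient_inv (quotient_proj a) = quotient_proj a^-1.
Proof.
apply/esym/quotient_projP; set a' := repr _; rewrite invgK.
have [N1 ND] := normal_is_subgroup N.
have Na : normal_set N (a' * a^-1).
  by have := ND _ _ N1 (normal_repr a); rewrite mul1g invgF.
by have := normal_conj a^-1 Na; rewrite invgK mulgA mulgVK.
Qed.

Lemma quotient_mulA : associative quotient_mul.
Proof.
move=> p q r; rewrite -(quotient_repr p) -(quotient_repr q) -(quotient_repr r).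
by rewrite !quotient_projM mulgA.
Qed.

Lemma quotient_mul1g : left_id quotient_one quotient_mul.
Proof. by move=> p; rewrite -(quotient_repr p) quotient_projM mul1g. Qed.

Lemma quotient_mulg1 : right_id quotient_one quotient_mul.
Proof. by move=> p; rewrite -(quotient_repr p) quotient_projM mulg1. Qed.

Lemma quotient_mulVg : left_inverse quotient_one quotient_inv quotient_mul.
Proof.
by move=> p; rewrite -(quotient_repr p) quotient_projV quotient_projM mulVg.
Qed.

Lemma quotient_mulgV : right_inverse quotient_one quotient_inv quotient_mul.
Proof.
by move=> p; rewrite -(quotient_repr p) quotient_projV quotient_projM mulgV.
Qed.

HB.instance Definition _ := isGroup.Build quotient_group
  quotient_mulA quotient_mul1g quotient_mulg1 quotient_mulVg quotient_mulgV.

End QuotientGroup.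

(* [(i, true)] stands for the i-th generator and [(i, false)] for its inverse.
   Letters are also the steps of edge paths in the lattice below. *)
Definition letter (d : nat) : Type := ('I_d * bool)%type.

Section FreeGroup.
Variable d : nat.
Implicit Types (a b : letter d) (u v w : seq (letter d)).

Definition letter_inv a : letter d := (a.1, ~~ a.2).

Definition reduced_word w := sorted [rel a b | b != letter_inv a] w.

Definition reduce_cons a w :=
  if w is b :: w' then if b == letter_inv a then w' else a :: w else [:: a].

Definition reduce_word w := foldr reduce_cons [::] w.

Definition word_inv w := rev (map letter_inv w).

Record free_group := FreeGroup {
  free_word :> seq (letter d);
  free_wordP : reduced_word free_word }.

HB.instance Definition _ := [isSub for free_word].
HB.instance Definition _ := [Choice of free_group by <:].

Lemma letter_invK : involutive letter_inv.
Proof. by case=> i s; rewrite /letter_inv /= negbK. Qed.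

Lemma reduce_cons_reduced a w : reduced_word w -> reduced_word (reduce_cons a w).
Proof.
rewrite /reduced_word; case: w => [//|b w] Hw /=.
by case: ifPn => [_|neq]; [exact: path_sorted Hw | rewrite /= neq].
Qed.

Lemma reduce_consK a w :
  reduced_word w -> reduce_cons a (reduce_cons (letter_inv a) w) = w.
Proof.
case: w => [|b w] Hw /=; first by rewrite eqxx.
rewrite letter_invK; case: eqVneq => [eq_ba|neq]; last by rewrite /= eqxx.
case: w Hw => [|c w] /=; first by rewrite eq_ba.
by rewrite eq_ba => /andP[/negbTE -> _].
Qed.

Lemma foldr_reduced u w :
  reduced_word w -> reduced_word (foldr reduce_cons w u).
Proof. by move=> Hw; elim: u => //= a u; apply: reduce_cons_reduced. Qed.

Lemma reduce_word_reduced w : reduced_word (reduce_word w).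
Proof. exact: foldr_reduced. Qed.

Lemma reduce_word_id w : reduced_word w -> reduce_word w = w.
Proof.
elim: w => //= a w IHw Hw; rewrite IHw; last exact: path_sorted Hw.
by case: w Hw {IHw} => //= b w /andP[/negbTE ->].
Qed.

Lemma reduce_word_cat u w :
  reduce_word (u ++ w) = foldr reduce_cons (reduce_word w) u.
Proof. by rewrite /reduce_word foldr_cat. Qed.

Lemma foldr_reduce u w :
  reduced_word w -> foldr reduce_cons w (reduce_word u) = foldr reduce_cons w u.
Proof.
move=> Hw; elim: u => //= a u <-; case: (reduce_word u) => //= b t.
case: eqVneq => //= ->; rewrite reduce_consK //; exact: foldr_reduced.
Qed.

Lemma word_invK w s :
  reduced_word s -> foldr reduce_cons s (w ++ word_inv w) = s.
Proof.
elim: w s => //= a w IHw s Hs.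
rewrite /word_inv map_cons rev_cons -cats1 catA foldr_cat /= IHw.
  by rewrite reduce_consK.
exact: reduce_cons_reduced.
Qed.

Lemma word_invI : involutive word_inv.
Proof. by move=> w; rewrite /word_inv map_rev revK mapK //; exact: letter_invK. Qed.

Definition free_of_word w : free_group := FreeGroup (reduce_word_reduced w).

Definition free_one : free_group := free_of_word [::].
Definition free_inv (x : free_group) := free_of_word (word_inv x).
Definition free_mul (x y : free_group) := free_of_word (x ++ y).

Lemma free_mulA : associative free_mul.
Proof.
move=> x y z; apply: val_inj => /=.
rewrite reduce_word_cat (reduce_word_id (reduce_word_reduced _)).
rewrite [in RHS]reduce_word_cat (foldr_reduce _ (reduce_word_reduced _)).
by rewrite -!reduce_word_cat catA.
Qed.

Lemma free_mul1g : left_id free_one free_mul.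
Proof. by move=> x; apply: val_inj; rewrite /= reduce_word_id //; exact: free_wordP. Qed.

Lemma free_mulg1 : right_id free_one free_mul.
Proof.
by move=> x; apply: val_inj; rewrite /= cats0 reduce_word_id //; exact: free_wordP.
Qed.

Lemma free_mulgV : right_inverse free_one free_inv free_mul.
Proof.
move=> x; apply: val_inj => /=.
rewrite reduce_word_cat (reduce_word_id (reduce_word_reduced _)).
by rewrite -foldr_cat word_invK.
Qed.

Lemma free_mulVg : left_inverse free_one free_inv free_mul.
Proof.
move=> x; apply: val_inj => /=.
rewrite reduce_word_cat (foldr_reduce _ (reduce_word_reduced _)).
by rewrite -foldr_cat -{2}(word_invI x) word_invK.
Qed.

HB.instance Definition _ := isGroup.Build free_group
  free_mulA free_mul1g free_mulg1 free_mulVg free_mulgV.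

Definition free_gen (i : 'I_d) : free_group := free_of_word [:: (i, true)].

End FreeGroup.

Definition Sol (d : nat) := quotient_group (derived2_normal (free_group d)).

HB.instance Definition _ d := Group.on (Sol d).

Definition sol_gen (d : nat) (i : 'I_d) : Sol d :=
  quotient_proj (derived2_normal (free_group d)) (free_gen i).

Definition expgz (G : groupType) (x : G) (k : int) : G :=
  match k with Posz n => (x ^+ n)%g | Negz n => (x ^- n.+1)%g end.

Definition sol_monomial (d : nat) (k : 'rV[int]_d) : Sol d :=
  (\prod_(i < d) expgz (sol_gen i) (k 0%R i))%g.

Section Lattice.
Local Open Scope ring_scope.
Variable d : nat.
Notation Zd := 'rV[int]_d.
Implicit Types (v w : Zd) (s : letter d) (p : seq (letter d)).

Definition basis_vec (i : 'I_d) : Zd := delta_mx 0 i.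

(* The edge [(v, i)] of the lattice complex is oriented from v to v + e_i. *)
Definition edge : Type := (Zd * 'I_d)%type.

HB.instance Definition _ := Choice.on edge.

Definition chain0 : Type := {freeg Zd / int}.
Definition chain1 : Type := {freeg edge / int}.

HB.instance Definition _ := GRing.Lmodule.on chain0.
HB.instance Definition _ := GRing.Lmodule.on chain1.

Definition point v : chain0 := << v >>.
Definition segment (e : edge) : chain1 := << e >>.

Definition boundary (c : chain1) : chain0 :=
  fglift (fun e : edge => point (e.1 + basis_vec e.2) - point e.1) c.

Definition shift_chain v (c : chain1) : chain1 :=
  fglift (fun e : edge => segment (v + e.1, e.2)) c.

Fact boundary_is_zmod_morphism : zmod_morphism boundary.
Proof. exact: lift_is_additive. Qed.

HB.instance Definition _ :=
  GRing.isZmodMorphism.Build chain1 chain0 boundary boundary_is_zmod_morphism.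

Fact shift_chain_is_zmod_morphism v : zmod_morphism (shift_chain v).
Proof. exact: lift_is_additive. Qed.

HB.instance Definition _ v := GRing.isZmodMorphism.Build chain1 chain1
  (shift_chain v) (shift_chain_is_zmod_morphism v).

Lemma boundary_segment e :
  boundary (segment e) = point (e.1 + basis_vec e.2) - point e.1.
Proof. by rewrite /boundary /segment liftU scale1r. Qed.

Lemma shift_segment v e : shift_chain v (segment e) = segment (v + e.1, e.2).
Proof. by rewrite /shift_chain /segment liftU scale1r. Qed.

Lemma chain1_ind (P : chain1 -> Prop) :
    P 0 -> (forall e c, P c -> P (segment e + c)) ->
    (forall e c, P c -> P (- segment e + c)) ->
  forall c, P c.
Proof.
move=> P0 Pp Pm; apply: freeg_ind_dom0 => // k e c _ _ Pc.
have -> : << k *g e >> = segment e *~ k.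
  apply/eqP/freeg_eqP => f; rewrite coeffU.
  have -> : coeff f (segment e *~ k) = coeff f (segment e) *~ k by rewrite raddfMz.
  by rewrite coeffU mul1r -mulrzr intz mulrC.
case: k => n; last rewrite NegzE mulrNz.
  elim: n => [|n IHn]; first by rewrite mulr0z add0r.
  by rewrite -pmulrn mulrS -addrA; apply: Pp.
elim: n.+1 => [|m IHm]; first by rewrite mulr0z oppr0 add0r.
by rewrite -pmulrn mulrS opprD -addrA; apply: Pm.
Qed.

(* As there are no cells of dimension two, H_1(E^d) is the group of 1-cycles. *)
Definition is_cycle : {pred chain1} := fun c => boundary c == 0.

Fact is_cycle_zmod_closed : zmod_closed is_cycle.
Proof.
split=> [|a b]; rewrite /in_mem /= /is_cycle; first by rewrite raddf0.
by move=> /eqP Ha /eqP Hb; rewrite raddfB /= Ha Hb subrr.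
Qed.

HB.instance Definition _ :=
  GRing.isZmodClosed.Build chain1 is_cycle is_cycle_zmod_closed.

Record H1 := Cycle { cycle_chain :> chain1; cycleP : cycle_chain \in is_cycle }.

HB.instance Definition _ := [isSub for cycle_chain].
HB.instance Definition _ := [Choice of H1 by <:].
HB.instance Definition _ := [SubChoice_isSubZmodule of H1 by <:].

Definition shift_chain0 v (c : chain0) : chain0 :=
  fglift (fun w => point (v + w)) c.

Fact shift_chain0_is_zmod_morphism v : zmod_morphism (shift_chain0 v).
Proof. exact: lift_is_additive. Qed.

HB.instance Definition _ v := GRing.isZmodMorphism.Build chain0 chain0
  (shift_chain0 v) (shift_chain0_is_zmod_morphism v).

Lemma shift_point v w : shift_chain0 v (point w) = point (v + w).
Proof. by rewrite /shift_chain0 /point liftU scale1r. Qed.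

Lemma boundary_shift v c :
  boundary (shift_chain v c) = shift_chain0 v (boundary c).
Proof.
have seg e : boundary (shift_chain v (segment e))
             = shift_chain0 v (boundary (segment e)).
  by rewrite shift_segment !boundary_segment raddfB /= !shift_point addrA.
elim/chain1_ind: c => [|e c IH|e c IH]; first by rewrite !raddf0.
  by rewrite !raddfD /= seg IH.
by rewrite !raddfD !raddfN /= seg IH.
Qed.

Lemma shift_chainD u v c :
  shift_chain (u + v) c = shift_chain u (shift_chain v c).
Proof.
elim/chain1_ind: c => [|e b IH|e b IH].
- by rewrite !raddf0.
- by rewrite !raddfD /= !shift_segment /= addrA IH.
by rewrite !raddfD !raddfN /= !shift_segment /= addrA IH.
Qed.

Lemma shift_chain_0 c : shift_chain 0 c = c.
Proof.
elim/chain1_ind: c => [|[v i] b IH|[v i] b IH].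
- by rewrite !raddf0.
- by rewrite raddfD /= !shift_segment /= add0r IH.
by rewrite raddfD raddfN /= !shift_segment /= add0r IH.
Qed.

Fact shift_cycle v (c : H1) : shift_chain v c \in is_cycle.
Proof.
by rewrite /in_mem /= /is_cycle boundary_shift (eqP (cycleP c)) raddf0.
Qed.

Definition shift v (c : H1) : H1 := Cycle (shift_cycle v c).

Fact shift_is_zmod_morphism v : zmod_morphism (shift v).
Proof. by move=> a b; apply: val_inj; rewrite /= raddfB. Qed.

HB.instance Definition _ v :=
  GRing.isZmodMorphism.Build H1 H1 (shift v) (shift_is_zmod_morphism v).

Lemma shiftD v w c : shift (v + w) c = shift v (shift w c).
Proof. by apply: val_inj; exact: shift_chainD. Qed.

Lemma shift0 c : shift 0 c = c.
Proof. by apply: val_inj; exact: shift_chain_0. Qed.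

(* An edge path is given by its initial vertex and by its successive steps:
   [(i, true)] goes from v to v + e_i and [(i, false)] from v to v - e_i. *)
Definition step_vec s : Zd :=
  if s.2 then basis_vec s.1 else - basis_vec s.1.

Definition step_chain v s : chain1 :=
  if s.2 then segment (v, s.1) else - segment (v - basis_vec s.1, s.1).

Fixpoint path_end v p : Zd :=
  if p is s :: p' then path_end (v + step_vec s) p' else v.

Fixpoint path_chain v p : chain1 :=
  if p is s :: p' then step_chain v s + path_chain (v + step_vec s) p' else 0.

Lemma boundary_path v p :
  boundary (path_chain v p) = point (path_end v p) - point v.
Proof.
elim: p v => [|[i s] p IHp] v /=; first by rewrite raddf0 subrr.
rewrite raddfD /= IHp /step_chain /step_vec; case: s => /=.
  by rewrite boundary_segment addrC subrKA.
by rewrite raddfN /= boundary_segment /= subrK opprB addrC subrKA.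
Qed.

Lemma boundary_shift_path v p :
  boundary (shift_chain v (path_chain 0 p)) = point (v + path_end 0 p) - point v.
Proof.
by rewrite boundary_shift boundary_path raddfB /= !shift_point addr0.
Qed.

Lemma closed_path_cycle v p : path_end v p = v -> path_chain v p \in is_cycle.
Proof. by move=> pv; rewrite /in_mem /= /is_cycle boundary_path pv subrr. Qed.

Definition coord_path (i j : 'I_d) : seq (letter d) :=
  [:: (i, true); (j, true); (i, false); (j, false)].

Fact coord_path_closed i j : path_end 0 (coord_path i j) = 0.
Proof.
by rewrite /= /step_vec /= add0r [basis_vec i + _]addrC addrK subrr.
Qed.

Definition coord_cycle i j : H1 :=
  Cycle (closed_path_cycle (coord_path_closed i j)).

Definition is_cocycle2 (z : Zd -> Zd -> H1) :=
  forall u v w, z u v + z (u + v) w = shift u (z v w) + z u (v + w).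

Record cocycle2 := Cocycle2 {
  cocycle2_fun :> Zd -> Zd -> H1;
  cocycle2P : is_cocycle2 cocycle2_fun }.

Definition cohomologous (z z' : cocycle2) := exists b : Zd -> H1,
  forall v w, z v w = z' v w + (b v + shift v (b w) - b (v + w)).

Record path_system := PathSystem {
  path_to :> Zd -> seq (letter d);
  path_toP : forall v, path_end 0 (path_to v) = v }.

Implicit Type tau : path_system.

Definition beta_chain tau v w : chain1 :=
  path_chain 0 (tau v) + shift_chain v (path_chain 0 (tau w))
  - path_chain 0 (tau (v + w)).

Fact beta_cycle tau v w : beta_chain tau v w \in is_cycle.
Proof.
rewrite /in_mem /= /is_cycle /beta_chain raddfB raddfD /=.
rewrite boundary_shift_path !boundary_path !path_toP; apply/eqP.
by rewrite [X in X - _]addrC subrKA subrr.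
Qed.

Definition beta_fun tau v w : H1 := Cycle (beta_cycle tau v w).

Fact beta_cocycle tau : is_cocycle2 (beta_fun tau).
Proof.
move=> u v w; apply: val_inj; rewrite /= /beta_chain.
rewrite raddfB raddfD /= shift_chainD addrA.
rewrite subrKA [X in _ = _ + (X - _)]addrC -[X in _ = _ + X]addrA subrKA.
by rewrite addrA -[X in X - _ = _]addrA [X in X - _ = _]addrC addrA.
Qed.

Definition beta tau : cocycle2 := Cocycle2 (beta_cocycle tau).

Fact beta_cohomologous tau tau' : cohomologous (beta tau) (beta tau').
Proof.
have dP v : path_chain 0 (tau v) - path_chain 0 (tau' v) \in is_cycle.
  by rewrite /in_mem /= /is_cycle raddfB /= !boundary_path !path_toP subrr.
exists (fun v => Cycle (dP v)) => v w; apply: val_inj => /=.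
rewrite /beta_chain raddfB /=.
set a := path_chain _ (tau v); set a' := path_chain _ (tau' v).
set b := shift_chain _ (path_chain _ (tau w)); set b' := shift_chain _ _.
set c := path_chain _ _; set c' := path_chain _ _.
rewrite opprB [RHS]addrACA addKr; congr (_ - _).
by rewrite (addrACA a) -opprD [RHS]addrC subrK.
Qed.

(* Membership in the class: by [beta_cohomologous], the set of cocycles
   satisfying this predicate is a single cohomology class. *)
Definition in_betabar (z : cocycle2) := exists tau, cohomologous z (beta tau).

(* The argument selects the group law put on the product. *)
Definition ext of cocycle2 : Type := (H1 * Zd)%type.

Section Extension.
Variable z : cocycle2.

HB.instance Definition _ := Choice.copy (ext z) (H1 * Zd)%type.

Definition ext_mul (x y : ext z) : ext z :=
  (x.1 + shift x.2 y.1 + z x.2 y.2, x.2 + y.2).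

(* The cocycle is not assumed to be normalized, whence the corrections by
   [z 0 0] here and in [ext_incl]. *)
Definition ext_one : ext z := (- z 0 0, 0).

Definition ext_inv (x : ext z) : ext z :=
  (- shift (- x.2) x.1 - z (- x.2) x.2 - z 0 0, - x.2).

Lemma cocycle2_0l v : z 0 v = z 0 0.
Proof.
have := cocycle2P z 0 0 v; rewrite shift0 !add0r => /addIr.
by move->.
Qed.

Lemma cocycle2_0r v : z v 0 = shift v (z 0 0).
Proof.
by have := cocycle2P z v 0 0; rewrite !addr0 => /addIr.
Qed.

Lemma ext_mulA : associative ext_mul.
Proof.
move=> [a u] [b v] [c w]; rewrite /ext_mul /=; congr (_, _); last exact: addrA.
rewrite !raddfD /= shiftD -!addrA; do 2!congr (_ + _).
by rewrite -cocycle2P addrCA.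
Qed.

Lemma ext_mul1g : left_id ext_one ext_mul.
Proof.
move=> [a v]; rewrite /ext_mul /=; congr (_, _); last exact: add0r.
by rewrite shift0 cocycle2_0l addrAC addNr add0r.
Qed.

Lemma ext_mulg1 : right_id ext_one ext_mul.
Proof.
move=> [a v]; rewrite /ext_mul /=; congr (_, _); last exact: addr0.
by rewrite (cocycle2_0r v) raddfN /= subrK.
Qed.

Lemma ext_mulVg : left_inverse ext_one ext_inv ext_mul.
Proof.
move=> [a v]; rewrite /ext_mul /ext_one /=; congr (_, _); last exact: addNr.
by rewrite -[LHS]addrA [LHS]addrAC -opprD addNr add0r.
Qed.

Lemma ext_mulgV : right_inverse ext_one ext_inv ext_mul.
Proof.
move=> [a v]; rewrite /ext_mul /ext_one /=; congr (_, _); last exact: addrN.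
rewrite !raddfB raddfN /= -shiftD subrr shift0.
have := cocycle2P z v (- v) v.
rewrite subrr addNr (cocycle2_0l v) (cocycle2_0r v) => /(canRL (addrK _)) ->.
by rewrite -[X in a + X]addrA -opprD [a + _]addrA subrr add0r addKr.
Qed.

HB.instance Definition _ := isGroup.Build (ext z)
  ext_mulA ext_mul1g ext_mulg1 ext_mulVg ext_mulgV.

Definition ext_incl (c : H1) : ext z := (c - z 0 0, 0).

End Extension.

Fact path_lift_proof tau p :
  path_chain 0 p - path_chain 0 (tau (path_end 0 p)) \in is_cycle.
Proof.
by rewrite /in_mem /= /is_cycle raddfB /= !boundary_path path_toP subrr.
Qed.

(* The element of the extension defined by an edge path p starting at 0: if
   (c, v) is thought of as the 1-chain c + tau_v with boundary v - 0, then
   this is the chain of p. *)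
Definition path_lift tau p : ext (beta tau) :=
  (Cycle (path_lift_proof tau p), path_end 0 p).

End Lattice.

Definition is_shift_isomorphism (d : nat) (z : cocycle2 d)
    (phi : ext z -> Sol d) : Prop :=
  [/\ bijective phi,
      {morph phi : a b / (a * b)%g},
      forall g : Sol d,
        (exists c : H1 d, phi (ext_incl z c) = g) <-> derived1 (Sol d) g,
      forall i j : 'I_d, i != j ->
        phi (ext_incl z (coord_cycle i j)) =
        (sol_gen i * sol_gen j * (sol_gen i)^-1 * (sol_gen j)^-1)%g
    & forall (k : 'rV[int]_d) (c : H1 d),
        phi (ext_incl z (shift k c)) =
        (sol_monomial k * phi (ext_incl z c) * (sol_monomial k)^-1)%g].

(* Main.v *)
Require Import Defs.
From HB Require Import structures.
From mathcomp Require Import all_boot all_order all_algebra.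
From mathcomp Require Import boolp classical_sets.
From mathcomp Require Import freeg.

Import GRing.Theory.
Local Open Scope ring_scope.

(* Sending an edge path p from 0 to v to the pair (chain of p - tau_v, v) is a
   homomorphism from F_d to the extension that kills F_d'', whence [sol_lift].
   Its inverse [sol_of_ext] sends the edge from v to v + e_i to the element
   tau_v x_i tau_(v + e_i)^-1 of Sol_d. This lies in the commutator subgroup
   because the abelianization of F_d is Z^d; as that subgroup is abelian, the
   assignment extends linearly to chains, and along an edge path the product of
   the images telescopes. *)

(** * Commutator subgroups and the abelianization of a group *)

Section DerivedSubgroup.
Local Open Scope group_scope.
Context {G : groupType}.
Implicit Types (A H : set G) (N : normal_subgroup G).

Lemma subgroupV {H} {a : G} : is_subgroup H -> H a -> H a^-1.
Proof. by move=> [H1 HD] Ha; rewrite -div1g; apply: HD. Qed.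

Lemma subgroupM {H} {a b : G} : is_subgroup H -> H a -> H b -> H (a * b).
Proof.
by move=> sgH Ha Hb; rewrite -(invgK b); apply: sgH.2 => //; apply: subgroupV.
Qed.

Lemma comm_subgroup_min {A H} : is_subgroup H ->
  (forall a b, A a -> A b -> H (a * b * a^-1 * b^-1)) ->
  forall g, comm_subgroup A g -> H g.
Proof.
by move=> sgH HA g; apply; split=> // _ [a [b [Aa Ab ->]]]; exact: HA.
Qed.

Lemma comm_subgroup_comm {A} {a b : G} :
  A a -> A b -> comm_subgroup A (a * b * a^-1 * b^-1).
Proof. by move=> Aa Ab H [_]; apply; exists a, b. Qed.

Lemma derived1_subgroup : is_subgroup (derived1 G).
Proof. exact: generated_subgroup. Qed.

Lemma derived1_conj : is_conj_stable (derived1 G).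
Proof. exact: comm_subgroup_conj. Qed.

Definition derived1_normal : normal_subgroup G :=
  NormalSubgroup derived1_subgroup derived1_conj.

HB.instance Definition _ N :=
  isUMagmaMorphism.Build G (quotient_group N) (quotient_proj N)
    (erefl, fun a b => esym (quotient_projM N a b)).

Lemma quotient_derived1_commute (p q : quotient_group derived1_normal) :
  commute p q.
Proof.
rewrite -(quotient_repr p) -(quotient_repr q) /commute -!gmulfM.
by apply/quotient_projP; rewrite invgM mulgA; apply: comm_subgroup_comm.
Qed.

End DerivedSubgroup.

(** * Integer powers in a group *)

Section IntegerPowers.
Local Open Scope group_scope.
Context {G : groupType}.

Lemma gmulf_expgz {G' : groupType} (f : UMagmaMorphism.type G G') x k :
  f (expgz x k) = expgz (f x) k.
Proof. by case: k => n; rewrite /= ?gmulfV gmulfXn. Qed.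

Lemma expgzS (x : G) (k : int) : expgz x (k + 1)%R = expgz x k * x.
Proof.
case: k => n; first by rewrite -PoszD addn1 /= expgSr.
rewrite NegzE -addn1 PoszD opprD subrK.
(* For n = 0 the new exponent is [Posz 0], otherwise it is a [Negz], so [expgz] unfolds differently
   in the two cases. *)
case: n => [|n]; first by rewrite /= mulVg.
by rewrite -NegzE [RHS]/= expgS invgM mulgVK addn0.
Qed.

Lemma prod_expgz_basis {d} (x : 'I_d -> G) (v : 'rV[int]_d) (i : 'I_d) :
  (forall a b : G, commute a b) ->
  \prod_j expgz (x j) ((v + basis_vec i)%R 0%R j) =
  (\prod_j expgz (x j) (v 0%R j)) * x i.
Proof.
move=> Gcomm.
(* The factor [x i] becomes a product over all j with factor 1 for j different from i; commutativity
   then merges the two products factor by factor. *)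
rewrite -(big_pred1_eq *%g i x) [in RHS]big_mkcond -prodgM_commute //.
apply: eq_bigr => j _; rewrite !mxE /=.
by case: eqP => _ /=; rewrite ?addr0 ?mulg1 // expgzS.
Qed.

End IntegerPowers.

(** * Edge paths under translation, concatenation and reduction *)

Section Paths.
Context {d : nat}.
Notation Zd := 'rV[int]_d.
Implicit Types (u v : Zd) (s : letter d) (p q : seq (letter d)).

Lemma path_end_shift u v p : path_end (u + v) p = u + path_end v p.
Proof. by elim: p v => //= s p IHp v; rewrite -addrA IHp. Qed.

Lemma path_end_cat v p q : path_end v (p ++ q) = path_end (path_end v p) q.
Proof. by elim: p v => /=. Qed.

Lemma path_chain_shift u v p :
  path_chain (u + v) p = shift_chain u (path_chain v p).
Proof.
elim: p v => [|[i b] p IHp] v /=; first by rewrite raddf0.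
rewrite raddfD -addrA IHp; congr (_ + _).
by case: b; rewrite /step_chain /= ?raddfN /= shift_segment //= addrA.
Qed.

Lemma path_chain_cat v p q :
  path_chain v (p ++ q) = path_chain v p + path_chain (path_end v p) q.
Proof. by elim: p v => [|s p IHp] v /=; rewrite ?add0r // IHp addrA. Qed.

Lemma step_vec_inv s : step_vec (letter_inv s) = - step_vec s.
Proof. by case: s => i []; rewrite /step_vec /= ?opprK. Qed.

Lemma step_chain_inv v s :
  step_chain (v + step_vec s) (letter_inv s) = - step_chain v s.
Proof. by case: s => i []; rewrite /step_chain /step_vec /= ?addrK ?opprK. Qed.

(** A cancelled pair of letters is a step followed by its backtrack, and the chains of the two are
    opposite. Hence the end and the chain of a path are functions on the free group. *)
Lemma reduce_word_path v p :
  path_end v (reduce_word p) = path_end v p /\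
  path_chain v (reduce_word p) = path_chain v p.
Proof.
elim: p v => [//|s p IHp] v /=; have [<- <-] := IHp (v + step_vec s).
case: (reduce_word p) => [//|t q] /=; case: eqVneq => [->|//] /=.
by rewrite step_vec_inv step_chain_inv addrK addNKr.
Qed.

End Paths.

(** * Extension of maps on a basis to free abelian groups *)

Section LinearExtension.
Context {K : choiceType} {V : zmodType}.
Variable f : K -> V.

(** [fglift] takes values in a module; [zmodule V] is V with its canonical module structure over the
    integers. *)
Definition zlift (c : {freeg K / int}) : V := fglift (f : K -> zmodule V) c.

Lemma zlift_unit x : zlift << x >> = f x.
Proof. by rewrite /zlift liftU; exact: mulr1z. Qed.

Fact zlift_is_zmod_morphism : zmod_morphism zlift.
Proof. exact: (@lift_is_additive _ _ (zmodule V)). Qed.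

HB.instance Definition _ :=
  GRing.isZmodMorphism.Build {freeg K / int} V zlift zlift_is_zmod_morphism.

End LinearExtension.

(** * Words in Sol_d, its abelianization and its commutator subgroup *)

Section SolPaths.
Local Open Scope group_scope.
Context {d : nat}.
Implicit Types (s : letter d) (p q : seq (letter d)).

Definition sol_proj : free_group d -> Sol d :=
  quotient_proj (derived2_normal (free_group d)).

HB.instance Definition _ := isUMagmaMorphism.Build (free_group d) (Sol d)
  sol_proj (erefl, fun a b => esym (quotient_projM _ a b)).

Definition sol_path p : Sol d := sol_proj (free_of_word p).

Lemma free_of_wordK (x : free_group d) : free_of_word x = x.
Proof. by apply: val_inj; rewrite /= reduce_word_id //; exact: free_wordP. Qed.

Definition sol_word (g : Sol d) : seq (letter d) := repr g.

Lemma sol_wordK : cancel sol_word sol_path.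
Proof.
by move=> g; rewrite /sol_path /sol_word free_of_wordK; exact: quotient_repr.
Qed.

Lemma sol_path_cat p q : sol_path (p ++ q) = sol_path p * sol_path q.
Proof.
rewrite /sol_path -gmulfM; congr sol_proj; apply: val_inj => /=.
rewrite [RHS]reduce_word_cat (reduce_word_id (reduce_word_reduced _)).
by rewrite foldr_reduce ?reduce_word_cat //; exact: reduce_word_reduced.
Qed.

Lemma sol_path_cons s p : sol_path (s :: p) = sol_path [:: s] * sol_path p.
Proof. exact: (sol_path_cat [:: s]). Qed.

Lemma sol_path_nil : sol_path [::] = 1.
Proof. exact: gmulf1. Qed.

Lemma sol_path_neg i : sol_path [:: (i, false)] = (sol_gen i)^-1.
Proof.
apply/esym/mulg1_eq; rewrite -[sol_gen i]/(sol_path [:: (i, true)]).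
rewrite -sol_path_cat -[RHS]sol_path_nil; congr sol_proj.
by apply: val_inj; rewrite /= eqxx.
Qed.

(** Elements of the commutator subgroup of Sol_d lift to that of F_d, and the commutator of two such
    lifts lies in F_d''. *)
Lemma Sol_metabelian (a b : Sol d) :
  derived1 (Sol d) a -> derived1 (Sol d) b -> commute a b.
Proof.
have lift g : derived1 (Sol d) g ->
    exists2 x, derived1 (free_group d) x & sol_proj x = g.
  move: g; apply: comm_subgroup_min => [|a' b' _ _].
    split=> [|_ _ [x Fx <-] [y Fy <-]].
      by exists 1; [exact: derived1_subgroup.1 | exact: gmulf1].
    by exists (x * y^-1); [exact: derived1_subgroup.2 | rewrite gmulfF].
  rewrite -(sol_wordK a') -(sol_wordK b').
  set x := free_of_word (sol_word a'); set y := free_of_word (sol_word b').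
  exists (x * y * x^-1 * y^-1); first exact: comm_subgroup_comm.
  by rewrite !gmulfM !gmulfV.
move=> /lift[x Fx <-] /lift[y Fy <-]; rewrite /commute -!gmulfM.
by apply/quotient_projP; rewrite invgM mulgA; exact: comm_subgroup_comm.
Qed.

Local Notation ab := (quotient_proj (derived1_normal (G := Sol d))).

(** The monomial in front stands for the starting vertex, so that the induction on p can move it
    along one edge at a time. *)
Lemma sol_abelianization_path v p :
  ab (sol_monomial v * sol_path p) = ab (sol_monomial (path_end v p)).
Proof.
have ab_basis u i :
      ab (sol_monomial (u + basis_vec i)%R) =
      ab (sol_monomial u) * ab (sol_gen i).
  rewrite /sol_monomial !gmulf_prod.
  under eq_bigr do rewrite gmulf_expgz.
  rewrite prod_expgz_basis; last exact: quotient_derived1_commute.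
  by under [in RHS]eq_bigr do rewrite gmulf_expgz.
elim: p v => [|s p IHp] v; first by rewrite sol_path_nil mulg1.
rewrite sol_path_cons mulgA gmulfM /= -IHp [in RHS]gmulfM; congr (_ * _).
case: s => i [] /=; rewrite /step_vec /=; first by rewrite ab_basis -gmulfM.
(* Writing v as [(v - e_i) + e_i] splits off a generator, which cancels against the inverse
   contributed by the backward step. *)
rewrite -[in LHS](subrK (basis_vec i) v) gmulfM /= ab_basis sol_path_neg.
by rewrite gmulfV mulgK.
Qed.

Lemma sol_path_derived1 p q : path_end 0%R p = path_end 0%R q ->
  derived1 (Sol d) (sol_path p * (sol_path q)^-1).
Proof.
move=> pq; apply: (quotient_projP derived1_normal _ _).1.
(* With the monomial of the vertex 0 in front, both sides are instances of
   [sol_abelianization_path], which sees only the ends of the paths. *)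
apply: (mulgI (ab (sol_monomial 0%R))).
by rewrite -!gmulfM /= !sol_abelianization_path pq.
Qed.

Lemma sol_path_loop_derived1 p :
  path_end 0%R p = 0%R -> derived1 (Sol d) (sol_path p).
Proof.
by move=> /(sol_path_derived1 p [::]); rewrite sol_path_nil divg1.
Qed.

(** The commutator subgroup as a type of its own, to be written additively so that [zlift] can take
    values in it. Membership is made boolean to obtain a subtype. *)
Record sol_derived := SolDerived {
  sol_derived_val : Sol d;
  sol_derivedP : `[< derived1 (Sol d) sol_derived_val >] }.

HB.instance Definition _ := [isSub for sol_derived_val].
HB.instance Definition _ := [Choice of sol_derived by <:].

Lemma sol_derived1 (a : sol_derived) : derived1 (Sol d) (val a).
Proof. exact/asboolP/(valP a). Qed.

Definition sol_derived_zero : sol_derived :=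
  SolDerived _ (asboolT (derived1_subgroup (G := Sol d)).1).
Definition sol_derived_opp (a : sol_derived) : sol_derived :=
  SolDerived _ (asboolT (subgroupV derived1_subgroup (sol_derived1 a))).
Definition sol_derived_add (a b : sol_derived) : sol_derived :=
  SolDerived _
    (asboolT (subgroupM derived1_subgroup (sol_derived1 a) (sol_derived1 b))).

Fact sol_derived_addA : associative sol_derived_add.
Proof. by move=> a b c; apply: val_inj; exact: mulgA. Qed.
Fact sol_derived_addC : commutative sol_derived_add.
Proof. by move=> a b; apply/val_inj/Sol_metabelian; exact: sol_derived1. Qed.
Fact sol_derived_add0 : left_id sol_derived_zero sol_derived_add.
Proof. by move=> a; apply: val_inj; exact: mul1g. Qed.
Fact sol_derived_addN :
  left_inverse sol_derived_zero sol_derived_opp sol_derived_add.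
Proof. by move=> a; apply: val_inj; exact: mulVg. Qed.

HB.instance Definition _ := GRing.isZmodule.Build sol_derived
  sol_derived_addA sol_derived_addC sol_derived_add0 sol_derived_addN.

End SolPaths.

(** * Conjugation and commutators in the extension *)

Section Extension.
Local Open Scope group_scope.
Context {d : nat}.
Variable z : cocycle2 d.
Implicit Types (a b : H1 d) (v : 'rV[int]_d) (x y : ext z).

Lemma ext_mulE x y : x * y = (x.1 + shift x.2 y.1 + z x.2 y.2, x.2 + y.2)%R.
Proof. by []. Qed.

Lemma ext_incl_pair a v : (a, v) = ext_incl z a * (0%R, v) :> ext z.
Proof. by rewrite ext_mulE /= cocycle2_0l raddf0 addr0 add0r subrK. Qed.

Lemma ext_inclD a b : ext_incl z (a + b)%R = ext_incl z a * ext_incl z b.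
Proof.
rewrite ext_mulE /= shift0 addr0; congr pair.
by rewrite -[RHS]addrA subrK addrAC.
Qed.

Lemma ext_inclN a : ext_incl z (- a)%R = (ext_incl z a)^-1.
Proof. by apply/esym/mulg1_eq; rewrite -ext_inclD subrr /ext_incl sub0r. Qed.

Lemma ext_incl_commute a b : commute (ext_incl z a) (ext_incl z b).
Proof. by rewrite /commute -!ext_inclD addrC. Qed.

Lemma ext_inclK x : x.2 = 0%R -> ext_incl z (x.1 + z 0 0)%R = x.
Proof. by case: x => a v /= ->; rewrite /ext_incl addrK. Qed.

(** This turns shifts into conjugations: of the conjugating element only the component in Z^d has to
    be known. *)
Lemma ext_conj_incl x a :
  x * ext_incl z a = ext_incl z (shift x.2 a) * x.
Proof.
rewrite !ext_mulE /= shift0 cocycle2_0l (cocycle2_0r _ x.2) raddfB addr0 add0r.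
by congr pair; rewrite -[LHS]addrA subrK [RHS]addrAC subrK addrC.
Qed.

(** The second component is a homomorphism to the abelian group Z^d, so it kills commutators. *)
Lemma ext_snd_derived1 {G : groupType} (f : UMagmaMorphism.type G (ext z)) g :
  derived1 G g -> (f g).2 = 0%R.
Proof.
move: g; apply: comm_subgroup_min => [|g h _ _].
  split=> [|g h]; first by rewrite gmulf1.
  by rewrite gmulfF /= => -> ->; rewrite subrr.
by rewrite !gmulfM !gmulfV /= addrAC addrK subrr.
Qed.

End Extension.

(** * The homomorphism from Sol_d to the extension and its inverse *)

Section Isomorphism.
Local Open Scope group_scope.
Context {d : nat}.
Variable tau : path_system d.
Notation Zd := 'rV[int]_d.
Notation E := (ext (beta tau)).
Implicit Types (u v : Zd) (e : edge d) (p q : seq (letter d)).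

(** With v and w the ends of p and q, the cocycle adds [tau_v + (v + tau_w) - tau_(v + w)]. This
    cancels the terms subtracted in the two factors and leaves the one subtracted for the
    concatenation. *)
Lemma path_lift_cat p q :
  path_lift tau (p ++ q) = path_lift tau p * path_lift tau q.
Proof.
have pE: path_end 0%R (p ++ q) = (path_end 0 p + path_end 0 q)%R.
  by rewrite path_end_cat -[X in path_end X q]addr0 path_end_shift.
congr pair; last exact: pE.
apply: val_inj => /=; rewrite pE path_chain_cat -[X in path_chain X q]addr0.
rewrite path_chain_shift raddfB /beta_chain /=.
by rewrite [X in _ = (X + _)%R]addrACA -opprD subrKA.
Qed.

Lemma path_lift_reduce p : path_lift tau (reduce_word p) = path_lift tau p.
Proof.
have [e c] := reduce_word_path 0%R p.
by congr pair; [apply: val_inj; rewrite /= e c | exact: e].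
Qed.

Definition free_lift (x : free_group d) : E := path_lift tau x.

Fact free_lift_monoid_morphism :
  (free_lift 1 = 1) * {morph free_lift : x y / x * y}.
Proof.
split=> [|x y].
  congr pair; apply: val_inj => /=.
  by rewrite /beta_chain shift_chain_0 addr0 addrK sub0r.
rewrite /free_lift -path_lift_cat; exact: path_lift_reduce.
Qed.

HB.instance Definition _ :=
  isUMagmaMorphism.Build (free_group d) E free_lift free_lift_monoid_morphism.

(** Elements of F_d' lie over 0 in Z^d, hence are sent into the image of H_1, which is abelian. *)
Lemma free_lift_derived2 (x : free_group d) :
  derived2 (free_group d) x -> free_lift x = 1.
Proof.
move: x; apply: comm_subgroup_min => [|x y].
  split=> [|x y]; first exact: gmulf1.
  by rewrite gmulfF /= => -> ->; rewrite mulgV.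
move=> /(ext_snd_derived1 _ free_lift) x0 /(ext_snd_derived1 _ free_lift) y0.
rewrite !gmulfM !gmulfV /=.
rewrite -(ext_inclK _ _ x0) -(ext_inclK _ _ y0).
by rewrite ext_incl_commute mulgK mulgV.
Qed.

Definition sol_lift (g : Sol d) : E := path_lift tau (sol_word g).

(** The representative chosen by [sol_lift] differs from p by an element of F_d'', which [free_lift]
    kills. *)
Lemma sol_lift_path p : sol_lift (sol_path p) = path_lift tau p.
Proof.
rewrite -[RHS]path_lift_reduce; apply/divg1_eq.
rewrite -[path_lift tau (reduce_word p)]/(free_lift (free_of_word p)).
rewrite /sol_lift -path_lift_reduce.
rewrite -[path_lift tau _]/(free_lift (free_of_word _)) -gmulfF.
apply: free_lift_derived2; apply: (quotient_projP (derived2_normal _) _ _).1.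
exact: sol_wordK.
Qed.

Fact sol_lift_monoid_morphism :
  (sol_lift 1 = 1) * {morph sol_lift : x y / x * y}.
Proof.
split=> [|g h].
  by rewrite -sol_path_nil sol_lift_path -[LHS]/(free_lift 1) gmulf1.
rewrite -(sol_wordK g) -(sol_wordK h) -sol_path_cat !sol_lift_path.
exact: path_lift_cat.
Qed.

HB.instance Definition _ :=
  isUMagmaMorphism.Build (Sol d) E sol_lift sol_lift_monoid_morphism.


Lemma path_lift_to v : path_lift tau (tau v) = (0%R, v).
Proof.
congr pair; last exact: path_toP.
by apply: val_inj; rewrite /= path_toP subrr.
Qed.

Definition path_cycle p : H1 d := Cycle (path_lift_proof tau p).

Lemma path_liftE p :
  path_lift tau p =
  ext_incl (beta tau) (path_cycle p) * path_lift tau (tau (path_end 0%R p)).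
Proof. by rewrite path_lift_to -ext_incl_pair. Qed.

Definition edge_path e := tau e.1 ++ [:: (e.2, true)].

Lemma edge_path_end e : path_end 0%R (edge_path e) = (e.1 + basis_vec e.2)%R.
Proof. by rewrite path_end_cat /= path_toP. Qed.

Lemma edge_path_derived1 e :
  derived1 (Sol d)
    (sol_path (edge_path e) * (sol_path (tau (e.1 + basis_vec e.2)%R))^-1).
Proof. by apply: sol_path_derived1; rewrite edge_path_end path_toP. Qed.

Definition sol_of_chain : chain1 d -> sol_derived :=
  zlift (fun e => SolDerived _ (asboolT (edge_path_derived1 e))).

(** A retraction of chains onto cycles: each edge is closed up by the paths of [tau] to its two
    ends. It allows identities about cycles to be checked on single edges. *)
Definition cycle_of_chain : chain1 d -> H1 d :=
  zlift (fun e => path_cycle (edge_path e)).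

Definition path_to_chain : chain0 d -> chain1 d :=
  zlift (fun v => path_chain 0%R (tau v)).

HB.instance Definition _ := GRing.Additive.on sol_of_chain.
HB.instance Definition _ := GRing.Additive.on cycle_of_chain.
HB.instance Definition _ := GRing.Additive.on path_to_chain.

Lemma cycle_of_chainE c :
  val (cycle_of_chain c) = (c - path_to_chain (boundary c))%R.
Proof.
have seg e : val (cycle_of_chain (segment e)) =
    (segment e - path_to_chain (boundary (segment e)))%R.
  rewrite boundary_segment raddfB /= /cycle_of_chain /path_to_chain.
  rewrite !zlift_unit /= edge_path_end path_chain_cat path_toP /step_chain /=.
  case: e => v i /=; rewrite addr0 opprB [RHS]addrA.
  by congr (_ - _)%R; exact: addrC.
elim/chain1_ind: c => [|e c IHc|e c IHc]; first by rewrite !raddf0 addr0.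
  by rewrite !raddfD /= seg IHc; exact: addrACA.
by rewrite !raddfD !raddfN /= seg IHc [in LHS]opprD; exact: addrACA.
Qed.

Lemma cycle_of_chainK (c : H1 d) : cycle_of_chain c = c.
Proof.
by apply: val_inj; rewrite cycle_of_chainE (eqP (cycleP c)) raddf0 subr0.
Qed.

Lemma sol_lift_chain c :
  sol_lift (val (sol_of_chain c)) = ext_incl (beta tau) (cycle_of_chain c).
Proof.
have seg e : sol_lift (val (sol_of_chain (segment e))) =
    ext_incl (beta tau) (cycle_of_chain (segment e)).
  rewrite /sol_of_chain /cycle_of_chain !zlift_unit /= gmulfF /= !sol_lift_path.
  by rewrite path_liftE edge_path_end mulgK.
elim/chain1_ind: c => [|e c IHc|e c IHc].
- by rewrite !raddf0 gmulf1 /ext_incl sub0r.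
- by rewrite !raddfD gmulfM /= IHc seg ext_inclD.
- by rewrite !raddfD !raddfN gmulfM gmulfV /= IHc seg ext_inclD ext_inclN.
Qed.

Lemma sol_of_path_chain v p :
  val (sol_of_chain (path_chain v p)) =
  sol_path (tau v) * sol_path p * (sol_path (tau (path_end v p)))^-1.
Proof.
have seg e : val (sol_of_chain (segment e)) =
    sol_path (tau e.1) * sol_gen e.2 *
    (sol_path (tau (e.1 + basis_vec e.2)%R))^-1.
  by rewrite /sol_of_chain zlift_unit /= sol_path_cat.
elim: p v => [|[i b] p IHp] v /=.
  by rewrite raddf0 sol_path_nil mulg1 mulgV.
rewrite raddfD /= IHp sol_path_cons; case: b; rewrite /step_vec /step_chain /=.
  by rewrite seg /= !mulgA mulgVK.
by rewrite raddfN /= seg /= subrK sol_path_neg !invgM invgK !mulgA mulgVK.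
Qed.

Definition sol_of_ext (x : E) : Sol d :=
  val (sol_of_chain x.1) * sol_path (tau x.2).

Lemma sol_of_extK : cancel sol_of_ext sol_lift.
Proof.
move=> [c v]; rewrite /sol_of_ext gmulfM /= sol_lift_chain sol_lift_path.
by rewrite path_lift_to -ext_incl_pair cycle_of_chainK.
Qed.

Lemma sol_of_ext_path p : sol_of_ext (path_lift tau p) = sol_path p.
Proof.
rewrite /sol_of_ext /= raddfB /= !sol_of_path_chain path_toP mulgK.
(* The closed path [tau 0] may be nonempty, so the two chains leave the factors [t0] and its
   inverse. They cancel because [t0] and [g] both lie in the abelian commutator subgroup. *)
set t0 := sol_path (tau 0%R); set t := sol_path (tau (path_end 0%R p)).
rewrite -(mulgA t0 (sol_path p)); set g := sol_path p * t^-1.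
have t0D : derived1 (Sol d) t0.
  by apply: sol_path_loop_derived1; exact: path_toP.
have gD : derived1 (Sol d) g by apply: sol_path_derived1; rewrite path_toP.
by rewrite (Sol_metabelian _ _ t0D gD) mulgK mulgVK.
Qed.

Lemma sol_liftK : cancel sol_lift sol_of_ext.
Proof. by move=> g; rewrite sol_of_ext_path sol_wordK. Qed.

Lemma sol_of_ext_incl_derived1 c :
  derived1 (Sol d) (sol_of_ext (ext_incl (beta tau) c)).
Proof.
apply: (subgroupM derived1_subgroup); first exact: sol_derived1.
by apply: sol_path_loop_derived1; exact: path_toP.
Qed.


(** The monomial and the word of [tau k] agree in the abelianization, so they differ by an element
    lying over 0, while [tau k] lifts to an element over k. *)
Lemma sol_lift_monomial_snd k : (sol_lift (sol_monomial k)).2 = k.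
Proof.
have m0 : sol_monomial (0%R : Zd) = 1 by apply: big1 => i _; rewrite mxE.
have := sol_abelianization_path 0%R (tau k).
rewrite m0 mul1g path_toP => /esym /quotient_projP kD.
have lift_div : {morph sol_lift : x y / x / y} by exact: gmulfF.
have : (sol_lift (sol_monomial k / sol_path (tau k))).2 = 0%R.
  exact: ext_snd_derived1.
rewrite lift_div sol_lift_path path_lift_to => /eqP.
by rewrite subr_eq0 => /eqP.
Qed.

Lemma sol_of_extM : {morph sol_of_ext : x y / x * y}.
Proof. exact: (can2_gmulfM (f := sol_lift) sol_liftK sol_of_extK). Qed.

(** The cocycle at (0, 0) is the chain of the loop [tau 0], so the correction in [ext_incl] is the
    term subtracted in [path_lift]. *)
Lemma ext_incl_closed_path p (p0 : path_end 0%R p = 0%R) :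
  ext_incl (beta tau) (Cycle (closed_path_cycle p0)) = path_lift tau p.
Proof.
congr pair; last exact/esym.
by apply: val_inj; rewrite /= p0 /beta_chain shift_chain_0 addr0 addrK.
Qed.

Lemma sol_of_ext_isomorphism : is_shift_isomorphism sol_of_ext.
Proof.
split.
- by exists sol_lift; [exact: sol_of_extK | exact: sol_liftK].
- exact: sol_of_extM.
- move=> g; split=> [[c <-]|gD]; first exact: sol_of_ext_incl_derived1.
  (* The added cocycle value undoes the correction built into [ext_incl]. *)
  exists ((sol_lift g).1 + beta tau 0 0)%R.
  by rewrite ext_inclK ?sol_liftK //; exact: ext_snd_derived1.
- move=> i j _; rewrite ext_incl_closed_path sol_of_ext_path /coord_path.
  rewrite sol_path_cons (sol_path_cons (j, true)) (sol_path_cons (i, false)).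
  by rewrite !sol_path_neg !mulgA.
- move=> k c; apply: (canRL (mulgK _)).
  (* The conjugation is moved to the extension, where the lift of the monomial acts through its
     component k. *)
  rewrite -[sol_monomial k]sol_liftK -!sol_of_extM ext_conj_incl.
  by rewrite sol_lift_monomial_snd.
Qed.

(** Every element of the extension is the lift of a word, hence a product of lifts of single letters
    and so of lifts of positive letters and their inverses. *)
Lemma sol_of_ext_unique (phi : E -> Sol d) : {morph phi : x y / x * y} ->
  (forall i, phi (path_lift tau [:: (i, true)]) = sol_gen i) ->
  phi = sol_of_ext.
Proof.
move=> phiM phi_gen; apply/funext => x; rewrite -[x]sol_of_extK.
rewrite sol_liftK -[in RHS](sol_wordK (sol_of_ext x)) /sol_lift.
have phi1 : phi 1 = 1 by apply: (mulgI (phi 1)); rewrite -phiM !mulg1.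
elim: (sol_word _) => [|[i b] p IHp].
  by rewrite -sol_lift_path sol_path_nil gmulf1.
rewrite (path_lift_cat [:: (i, b)]) phiM IHp sol_path_cons; congr (_ * _).
case: b => //=.
rewrite sol_path_neg -sol_lift_path sol_path_neg gmulfV /=.
apply: (mulIg (sol_gen i)); rewrite mulVg -[X in _ * X]phi_gen.
by rewrite -sol_lift_path -phiM mulVg.
Qed.

End Isomorphism.

(** * Transport along cohomologous cocycles *)

Section ChangeOfCocycle.
Context {d : nat}.
Variables (z z' : cocycle2 d) (b : 'rV[int]_d -> H1 d).
Hypothesis zz' : forall v w,
  z v w = z' v w + (b v + shift v (b w) - b (v + w)).

(** The section [(0, v)] of the first extension goes to [(b v, v)]: the cochain [b] is the change of
    section relating the two cocycles. *)
Definition ext_change (x : ext z) : ext z' := (x.1 + b x.2, x.2).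

Lemma ext_change_bij : bijective ext_change.
Proof.
exists (fun y : ext z' => (y.1 - b y.2, y.2) : ext z) => [] [a v];
  by rewrite /ext_change /= ?addrK ?subrK.
Qed.

Lemma ext_changeM : {morph ext_change : x y / (x * y)%g}.
Proof.
move=> x y; rewrite !ext_mulE /ext_change /= zz' raddfD /=; congr pair.
rewrite -!addrA addNr addr0; congr (_ + _).
by rewrite addrCA [RHS]addrCA [LHS]addrC -!addrA.
Qed.

(** At (0, 0) the coboundary of [b] equals [b 0], which is exactly the difference between the
    corrections [z 0 0] and [z' 0 0]. *)
Lemma ext_change_incl c : ext_change (ext_incl z c) = ext_incl z' c.
Proof.
by rewrite /ext_change /= zz' shift0 !addr0 addrK opprD -addrA subrK.
Qed.

Lemma is_shift_isomorphism_change (phi : ext z' -> Sol d) :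
  is_shift_isomorphism phi -> is_shift_isomorphism (phi \o ext_change).
Proof.
case=> phi_bij phiM phi_derived phi_coord phi_shift; split.
- exact: bij_comp phi_bij ext_change_bij.
- by move=> x y; rewrite /= ext_changeM phiM.
- move=> g; rewrite -phi_derived.
  by split=> -[c <-]; exists c; rewrite /= ext_change_incl.
- by move=> i j ij; rewrite /= ext_change_incl phi_coord.
- by move=> k c; rewrite /= !ext_change_incl phi_shift.
Qed.

End ChangeOfCocycle.

Theorem theorem1 (d : nat) (hd : (0 < d)%N) :
  (forall z : cocycle2 d, in_betabar z ->
     exists phi : ext z -> Sol d, is_shift_isomorphism phi) /\
  (forall tau : path_system d,
     exists! phi : ext (beta tau) -> Sol d,
       is_shift_isomorphism phi /\
       forall i : 'I_d, phi (path_lift tau [:: (i, true)]) = sol_gen i).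
Proof.
split=> [z [tau [b zb]]|tau].
  exists (sol_of_ext tau \o ext_change z (beta tau) b).
  exact: is_shift_isomorphism_change zb _ (sol_of_ext_isomorphism tau).
exists (sol_of_ext tau); split.
  by split=> [|i]; [exact: sol_of_ext_isomorphism | exact: sol_of_ext_path].
by move=> phi [[_ phiM _ _ _] phi_gen]; rewrite (sol_of_ext_unique tau phi).
Qed.
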